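(* Let $d,M\geq 1$, let $t_1,\ldots,t_M\in[0,1)^d$ be pairwise different, let $c_1,\ldots,c_M\in\mathbb{C}\setminus\{0\}$, let $n\in\mathbb{N}$, and let $z_j$, $T$, $S_1,\ldots,S_d$, $C_\mu$ and $\lambda_j(\mu)$ be defined as in the context, where it is assumed that $T$ has rank $M$. If $\mu\in\mathbb{C}^d$ is such that $\lambda_1(\mu),\ldots,\lambda_M(\mu)$ are pairwise different, then any invertible matrix $W\in\mathbb{C}^{M\times M}$ that diagonalizes $C_\mu$ (that is, $W^{-1}C_\mu W$ is diagonal) also simultaneously diagonalizes $S_1,\ldots,S_d$ (that is, $W^{-1}S_\ell W$ is diagonal for every $\ell=1,\ldots,d$).
   Context: Notation: $\langle x,y\rangle=\sum_{\ell=1}^d x_\ell\overline{y_\ell}$ is the standard inner product on $\mathbb{C}^d$ (linear in the first argument), and $e_1,\ldots,e_d$ are the standard basis vectors. A star denotes the conjugate transpose. Given pairwise different $t_1,\ldots,t_M\in[0,1)^d$ and nonzero $c_1,\ldots,c_M\in\mathbb{C}$, put $$z_j:=(e^{-2\pi i t_{j,1}},\ldots,e^{-2\pi i t_{j,d}})\in\mathbb{C}^d,\qquad f(k):=\sum_{j=1}^M c_j e^{-2\pi i\langle t_j,k\rangle},\quad k\in\mathbb{Z}^d.$$ For $n\in\mathbb{N}$ let $I_n:=\{0,\ldots,n\}^d$ with a fixed ordering of its elements, let $N:=\#I_n=(n+1)^d$, and define the $N\times N$ matrices $$T:=(f(k-l))_{k,l\in I_n},\qquad T_\ell:=(f(k-l+e_\ell))_{k,l\in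 I_n},\quad \ell=1,\ldots,d.$$ If $T$ has rank $M$, let $T=U\Sigma V^*$ be a reduced singular value decomposition, where $\Sigma\in\mathbb{R}^{M\times M}$ is diagonal and positive definite and $U,V\in\mathbb{C}^{N\times M}$ satisfy $U^*U=V^*V=\mathrm{id}_{M\times M}$. Then define the $M\times M$ matrices $$S_\ell:=U^*T_\ell V\Sigma^{-1},\quad \ell=1,\ldots,d,\qquad C_\mu:=\sum_{\ell=1}^d\overline{\mu}_\ell S_\ell,\quad \mu\in\mathbb{C}^d.$$ Finally, $\lambda_j(\mu):=\langle z_j,\mu\rangle$, $j=1,\ldots,M$; these numbers are the eigenvalues of $C_\mu$. *)

(* Defs.v *)
From mathcomp Require Import all_boot all_order all_algebra.
From mathcomp Require Import complex.
From mathcomp Require Import reals sequences trigo.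

Set Implicit Arguments.
Unset Strict Implicit.
Unset Printing Implicit Defensive.

Import Order.TTheory GRing.Theory Num.Theory.

Local Open Scope ring_scope.
Local Open Scope complex_scope.
Local Open Scope sesquilinear_scope.

Definition expc (R : realType) (x : R[i]) : R[i] :=
  (expR (complex.Re x))%:C * (cos (complex.Im x) +i* sin (complex.Im x)).

Definition expm2pii (R : realType) (x : R[i]) : R[i] :=
  expc (- ((2 * pi)%:C * 'i%C * x)).

(* C^d is ['rV[R[i]]_d] with the library's [dotmx], which is linear in the
   first argument and conjugate-linear in the second. *)
Definition node (R : realType) (d : nat) (t : 'rV[R]_d) : 'rV[R[i]]_d :=
  \row_l expm2pii ((t 0 l)%:C).

Definition expsum (R : realType) (d M : nat) (t : 'I_M -> 'rV[R]_d)
    (c : 'I_M -> R[i]) (k : 'rV[int]_d) : R[i] :=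
  \sum_(j < M) c j *
    expm2pii (dotmx (map_mx (fun x : R => x%:C) (t j))
                    (map_mx (fun a : int => a%:~R) k)).

Definition grid_point (d n : nat) (k : 'rV['I_n.+1]_d) : 'rV[int]_d :=
  map_mx (fun a : 'I_n.+1 => (nat_of_ord a)%:Z) k.

(* The type ['rV['I_n.+1]_d] is the grid {0,...,n}^d; the ordering of its
   elements is the enumeration [idx], which is meant to be bijective.
   [toepl] has entries f(k - l + s): [s := 0] gives the matrix T, and
   [s := 'e_l] gives the matrix T_l. *)
Definition toepl (R : realType) (d M n : nat) (t : 'I_M -> 'rV[R]_d)
    (c : 'I_M -> R[i]) (idx : 'I_(n.+1 ^ d)%N -> 'rV['I_n.+1]_d)
    (s : 'rV[int]_d) : 'M[R[i]]_(n.+1 ^ d)%N :=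
  \matrix_(a, b)
    expsum t c (grid_point (idx a) - grid_point (idx b) + s).

Definition posdefmx (R : realType) (m : nat) (A : 'M[R]_m) : Prop :=
  A^T = A /\ forall x : 'cV[R]_m, x != 0 -> 0 < (x^T *m A *m x) 0 0.

Definition complexmx (R : realType) (m n : nat) (A : 'M[R]_(m, n)) :
    'M[R[i]]_(m, n) := map_mx (fun x : R => x%:C) A.

Definition reduced_svd (R : realType) (N M : nat) (T : 'M[R[i]]_N)
    (U : 'M[R[i]]_(N, M)) (Sigma : 'M[R]_M) (V : 'M[R[i]]_(N, M)) : Prop :=
  [/\ is_diag_mx Sigma, posdefmx Sigma,
      U ^t* *m U = 1%:M, V ^t* *m V = 1%:M
    & T = U *m complexmx Sigma *m V ^t*].

Definition svd_compress (R : realType) (N M : nat)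
    (U : 'M[R[i]]_(N, M)) (Sigma : 'M[R]_M) (V : 'M[R[i]]_(N, M))
    (A : 'M[R[i]]_N) : 'M[R[i]]_M :=
  U ^t* *m A *m V *m invmx (complexmx Sigma).

Definition conj_comb (R : realType) (d M : nat) (S : 'I_d -> 'M[R[i]]_M)
    (mu : 'rV[R[i]]_d) : 'M[R[i]]_M :=
  \sum_(l < d) (mu 0 l)^*%R *: S l.

(* Main.v *)
Require Import Defs.
From mathcomp Require Import all_boot all_order all_algebra.
From mathcomp Require Import complex.
From mathcomp Require Import reals sequences exp trigo.
From mathcomp Require Import ring.

(** Every [S l] is conjugate to the diagonal matrix of the [l]-th coordinates
    of the nodes, by one and the same matrix. The function
    [k |-> exp(-2 pi i <t_j, k>)] turns sums into products, so the shifted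
    Toeplitz matrix factors through the [M] nodes as
    [T_s = L *m diag_mx (character at s) *m K], where only the middle factor
    depends on the shift [s], and this factor is the identity for [s = 0]
    ([toepl_factor]). The singular value decomposition gives
    [Sigma = U^* T V = (U^* L) (K V)], a product of two square matrices. It is
    invertible because [T] has rank [M], hence so is [P := U^* L], and
    [S l = P *m diag_mx (z_{j,l})_j *m P^-1] ([compress_factor]).

    By linearity [C_mu = P *m diag_mx (lambda_j(mu))_j *m P^-1]. If [W]
    diagonalizes [C_mu], the columns of [P^-1 *m W] are eigenvectors of the
    diagonal matrix with entries [lambda_j(mu)]. These entries are pairwise
    different, so each such column is a multiple of a standard basis vector,
    and is therefore an eigenvector of every diagonal matrix
    ([diag_mx_intertwine]). Hence [W] diagonalizes every [S l]
    ([conj_diag_transfer]). *)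

Set Implicit Arguments.
Unset Strict Implicit.
Unset Printing Implicit Defensive.

Import Order.TTheory GRing.Theory Num.Theory.

Local Open Scope ring_scope.

(** A column of [G] with two nonzero entries, in rows [i] and [i'], would force
    [lam i = e = lam i']. So each column has at most one nonzero entry, and
    any diagonal matrix maps it to a multiple of itself. *)
Lemma diag_mx_intertwine (F : idomainType) (m p : nat) (lam z : 'rV[F]_m)
    (e : 'rV[F]_p) (G : 'M[F]_(m, p)) :
    injective (lam 0) -> diag_mx lam *m G = G *m diag_mx e ->
  exists y : 'rV[F]_p, diag_mx z *m G = G *m diag_mx y.
Proof.
move=> lam_inj /matrixP lamG.
have entry i j : G i j != 0 -> lam 0 i = e 0 j.
  move=> Gij; have := lamG i j; rewrite mul_diag_mx mul_mx_diag !mxE mulrC.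
  exact: mulfI.
(* The default value serves the zero columns. *)
exists (\row_j if [pick i | G i j != 0] is Some i then z 0 i else 0).
apply/matrixP => i j; rewrite mul_diag_mx mul_mx_diag !mxE mulrC.
case: (eqVneq (G i j) 0) => [->|Gij]; first by rewrite !mul0r.
case: pickP => [i' Gi'j|/(_ i)]; last by rewrite Gij.
by rewrite (lam_inj i' i) // (entry _ _ Gij) (entry _ _ Gi'j).
Qed.

Lemma conj_diag_transfer (F : fieldType) (m : nat) (lam z : 'rV[F]_m)
    (P W : 'M[F]_m) : P \in unitmx -> W \in unitmx -> injective (lam 0) ->
    is_diag_mx (invmx W *m (P *m diag_mx lam *m invmx P) *m W) ->
  is_diag_mx (invmx W *m (P *m diag_mx z *m invmx P) *m W).
Proof.
move=> Pu Wu lam_inj /diag_mxP[e defe].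
have [|y defy] :=
    @diag_mx_intertwine _ _ _ lam z e (invmx P *m W) lam_inj.
  by rewrite -defe !mulmxA mulmxK // mulVmx // mul1mx.
rewrite -!mulmxA defy !mulmxA mulmxK // mulVmx // mul1mx.
exact: diag_mx_is_diag.
Qed.

Lemma compress_unit (F : comUnitRingType) (N m : nat) (X : 'M[F]_(m, N))
    (L : 'M[F]_(N, m)) (K : 'M[F]_(m, N)) (Y : 'M[F]_(N, m))
    (Sigma : 'M[F]_m) :
    Sigma \in unitmx -> X *m (L *m K) *m Y = Sigma -> X *m L \in unitmx.
Proof.
move=> Su defS; move: Su; rewrite -defS.
have -> : X *m (L *m K) *m Y = X *m L *m (K *m Y) by rewrite !mulmxA.
by rewrite unitmx_mul => /andP[].
Qed.

(** With [Q := K *m Y] the product [(X *m L) *m Q] is [Sigma], so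
    [Q *m Sigma^-1] is the inverse of [X *m L]. *)
Lemma compress_factor (F : comUnitRingType) (N m : nat) (X : 'M[F]_(m, N))
    (L : 'M[F]_(N, m)) (D : 'M[F]_m) (K : 'M[F]_(m, N)) (Y : 'M[F]_(N, m))
    (Sigma : 'M[F]_m) :
    Sigma \in unitmx -> X *m (L *m K) *m Y = Sigma ->
  X *m (L *m D *m K) *m Y *m invmx Sigma
    = (X *m L) *m D *m invmx (X *m L).
Proof.
move=> Su defS.
have Pu := compress_unit Su defS.
have defS' : Sigma = (X *m L) *m (K *m Y) by rewrite -defS !mulmxA.
have -> : X *m (L *m D *m K) *m Y = X *m L *m D *m (K *m Y).
  by rewrite !mulmxA.
by rewrite -(mulKmx Pu (K *m Y)) -defS' !mulmxA mulmxK.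
Qed.

Local Open Scope complex_scope.
Local Open Scope sesquilinear_scope.

Section Character.
Variable R : realType.

Lemma expcD (x y : R[i]) : expc (x + y) = expc x * expc y.
Proof.
case: x y => [a b] [a' b']; rewrite /expc /= expRD cosD sinD.
apply/eqP; rewrite eq_complex /=; apply/andP; split; apply/eqP; ring.
Qed.

Lemma expm2piiD (x y : R[i]) :
  expm2pii (x + y) = expm2pii x * expm2pii y.
Proof. by rewrite /expm2pii mulrDr opprD expcD. Qed.

Lemma expm2pii0 : expm2pii (0 : R[i]) = 1.
Proof.
by rewrite /expm2pii mulr0 oppr0 /expc expR0 cos0 sin0 mul1r.
Qed.

Variable d : nat.

(** The character of the group Z^d with frequency [t]. *)
Definition character (t : 'rV[R]_d) (k : 'rV[int]_d) : R[i] :=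
  expm2pii (dotmx (map_mx (fun x : R => x%:C) t)
                  (map_mx (fun a : int => a%:~R) k)).

Lemma characterD t k l :
  character t (k + l) = character t k * character t l.
Proof.
rewrite /character -expm2piiD !dotmxE; congr expm2pii.
rewrite !mxE -big_split; apply: eq_bigr => i _ /=.
by rewrite !mxE rmorphD /= rmorphD mulrDr.
Qed.

Lemma character0 t : character t 0 = 1.
Proof.
rewrite /character dotmxE mxE big1 ?expm2pii0 // => i _.
by rewrite !mxE mulr0z rmorph0 mulr0.
Qed.

Lemma character_delta t l : character t (delta_mx 0 l) = node t 0 l.
Proof.
rewrite /character dotmxE mxE (bigD1 l) //= big1 ?addr0 => [|i il].
  by rewrite !mxE !eqxx mulr1z rmorph1 mulr1.
by rewrite !mxE (negbTE il) andbF mulr0z rmorph0 mulr0.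
Qed.

(** The coefficients [c j] may sit in either outer factor: neither depends on
    the shift [s]. *)
Lemma toepl_factor (M n : nat) (t : 'I_M -> 'rV[R]_d) (c : 'I_M -> R[i])
    (idx : 'I_(n.+1 ^ d)%N -> 'rV['I_n.+1]_d) :
  exists (L : 'M[R[i]]_((n.+1 ^ d)%N, M)) (K : 'M[R[i]]_(M, (n.+1 ^ d)%N)),
  forall s, toepl t c idx s = L *m diag_mx (\row_j character (t j) s) *m K.
Proof.
exists (\matrix_(a, j) character (t j) (grid_point (idx a))).
exists (\matrix_(j, b) (c j * character (t j) (- grid_point (idx b)))).
move=> s; apply/matrixP => a b; rewrite mul_mx_diag mxE [RHS]mxE.
apply: eq_bigr => j _; rewrite !mxE.
transitivity (c j * character (t j)
  (grid_point (idx a) - grid_point (idx b) + s)); first by [].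
by rewrite !characterD [RHS]mulrCA [in RHS]mulrAC.
Qed.

End Character.

Lemma reduced_svd_compress (R : realType) (N M : nat) (T : 'M[R[i]]_N)
    (U : 'M[R[i]]_(N, M)) (Sigma : 'M[R]_M) (V : 'M[R[i]]_(N, M)) :
  reduced_svd T U Sigma V -> U ^t* *m T *m V = complexmx Sigma.
Proof.
by case=> _ _ UU VV ->; rewrite !mulmxA UU mul1mx -mulmxA VV mulmx1.
Qed.

(** The rank of a product is at most that of its middle factor, so the
    [M]-by-[M] matrix [Sigma] has full rank. *)
Lemma reduced_svd_unit (R : realType) (N M : nat) (T : 'M[R[i]]_N)
    (U : 'M[R[i]]_(N, M)) (Sigma : 'M[R]_M) (V : 'M[R[i]]_(N, M)) :
  reduced_svd T U Sigma V -> \rank T = M -> complexmx Sigma \in unitmx.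
Proof.
case=> _ _ _ _ -> rk; rewrite -row_free_unit -row_leq_rank -{1}rk.
exact: leq_trans (mxrankM_maxl _ _) (mxrankM_maxr _ _).
Qed.

(** All the compressed shifted matrices are conjugate to diagonal ones by the
    same matrix [P := U^* L], where [L] is the left factor of [toepl_factor]. *)
Lemma compress_toepl (R : realType) (d M n : nat) (t : 'I_M -> 'rV[R]_d)
    (c : 'I_M -> R[i]) (idx : 'I_(n.+1 ^ d)%N -> 'rV['I_n.+1]_d)
    (U : 'M[R[i]]_((n.+1 ^ d)%N, M)) (Sigma : 'M[R]_M)
    (V : 'M[R[i]]_((n.+1 ^ d)%N, M)) :
    reduced_svd (toepl t c idx 0) U Sigma V -> \rank (toepl t c idx 0) = M ->
  exists2 P : 'M[R[i]]_M, P \in unitmx & forall l,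
    svd_compress U Sigma V (toepl t c idx (delta_mx 0 l))
      = P *m diag_mx (\row_j node (t j) 0 l) *m invmx P.
Proof.
move=> svdT rankT; have [L [K defT]] := toepl_factor t c idx.
have Su := reduced_svd_unit svdT rankT.
have T0 : toepl t c idx 0 = L *m K.
  rewrite defT; have -> : \row_j character (t j) 0 = const_mx 1.
    by apply/rowP => j; rewrite !mxE character0.
  by rewrite diag_const_mx mulmx1.
have defS := reduced_svd_compress svdT; rewrite T0 in defS.
exists (U ^t* *m L) => [|l]; first exact: compress_unit Su defS.
rewrite /svd_compress defT (compress_factor _ Su defS).
suff -> : \row_j character (t j) (delta_mx 0 l) = \row_j node (t j) 0 l by [].
by apply/rowP => j; rewrite mxE character_delta [RHS]mxE.
Qed.

Theorem corollary2p2 (R : realType) (d M n : nat)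
    (d_ge1 : (1 <= d)%N) (M_ge1 : (1 <= M)%N)
    (t : 'I_M -> 'rV[R]_d) (t_inj : injective t)
    (t_in01 : forall (j : 'I_M) (l : 'I_d), 0 <= t j 0 l < 1)
    (c : 'I_M -> R[i]) (c_neq0 : forall j : 'I_M, c j != 0)
    (idx : 'I_(n.+1 ^ d)%N -> 'rV['I_n.+1]_d) (idx_bij : bijective idx)
    (rankT : \rank (toepl t c idx 0) = M)
    (U : 'M[R[i]]_((n.+1 ^ d)%N, M)) (Sigma : 'M[R]_M)
    (V : 'M[R[i]]_((n.+1 ^ d)%N, M))
    (svdT : reduced_svd (toepl t c idx 0) U Sigma V)
    (S : 'I_d -> 'M[R[i]]_M)
    (S_def : forall l : 'I_d,
       S l = svd_compress U Sigma V (toepl t c idx (delta_mx 0 l)))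
    (mu : 'rV[R[i]]_d)
    (lambda_inj : injective (fun j : 'I_M => dotmx (node (t j)) mu))
    (W : 'M[R[i]]_M) (W_unit : W \in unitmx)
    (W_diag : is_diag_mx (invmx W *m conj_comb S mu *m W)) :
  forall l : 'I_d, is_diag_mx (invmx W *m S l *m W).
Proof.
have [P Pu SE] := compress_toepl svdT rankT.
have {}SE l : S l = P *m diag_mx (\row_j node (t j) 0 l) *m invmx P.
  by rewrite S_def SE.
pose lam : 'rV_M := \row_j dotmx (node (t j)) mu.
have CE : conj_comb S mu = P *m diag_mx lam *m invmx P.
  have -> : diag_mx lam =
      \sum_l (mu 0 l)^*%R *: diag_mx (\row_j node (t j) 0 l).
    apply/matrixP => i j; rewrite !mxE dotmxE summxE mxE -sumrMnl.
    by apply: eq_bigr => l _; rewrite !mxE mulrnAr mulrC.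
  rewrite mulmx_sumr mulmx_suml; apply: eq_bigr => l _.
  by rewrite SE -scalemxAr -scalemxAl.
have lam_inj : injective (lam 0) by move=> i j; rewrite !mxE => /lambda_inj.
rewrite CE in W_diag => l; rewrite SE.
exact: conj_diag_transfer Pu W_unit lam_inj W_diag.
Qed.
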